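(* Let $\mathcal{F}$ be a countable collection of functions $f:\mathbb{Z}\to\mathbb{Z}$ such that $f(n)\to+\infty$ as $n\to+\infty$ for every $f\in\mathcal{F}$. Let \[E_{\mathcal{F}}=\{x\in(0,1]: \{d_n(x)\}_{n\ge1}\text{ is strictly increasing and contains any finite pattern of }\mathcal{F}\}.\] Then $\dim_H E_{\mathcal{F}}=1$.
   Context: Engel expansion: for $x\in(0,1]$ define the Engel map $T:(0,1]\to(0,1]$ by $T(x)=(x-\frac{1}{n+1})(n+1)$ for $x\in(\frac{1}{n+1},\frac1n]$, $n\ge1$, and the digits $d_1(x)=\lfloor 1/x\rfloor+1$, $d_n(x)=d_1(T^{n-1}(x))$ for $n\ge1$ (with $T^0$ the identity). Then $x=\sum_{n\ge1}\frac{1}{d_1(x)\cdots d_n(x)}$, and $\{d_n(x)\}_{n\ge1}$ is called the Engel digit sequence of $x$. A set $A$ of positive integers (here the set of values $\{d_n(x):n\ge1\}$) is said to contain any finite pattern of $\mathcal{F}$ if for any finitely many functions $f_{1},\dots,f_{k}\in\mathcal{F}$ there exists $n\in\mathbb{N}$ with $\{f_1(n),\dots,f_k(n)\}\subset A$. $\dim_H$ denotes Hausdorff dimension. *)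

(* Defs.v *)
From mathcomp Require Import all_boot all_order all_algebra.
From mathcomp Require Import all_classical all_reals all_analysis.

Set Implicit Arguments.
Unset Strict Implicit.
Unset Printing Implicit Defensive.

Import Order.TTheory GRing.Theory Num.Theory.

Local Open Scope classical_set_scope.
Local Open Scope ring_scope.

Section hausdorff.
Context {R : realType}.
Implicit Types (U A : set R) (s delta : R).

(* [diam set0 = -oo]; [hausdorff_gauge] treats the empty set separately. *)
Definition diam U : \bar R := ereal_sup [set `|x - y|%:E | x in U & y in U].

(* |U|^s, with the usual conventions |{x}|^0 = 1 and |set0|^s = 0 even for
   s = 0. *)
Definition hausdorff_gauge s U : \bar R :=
  if U == set0 then 0%E else (diam U `^ s)%E.

(* A finite cover is padded with empty sets. *)
Definition delta_cover delta A (U : (set R)^nat) : Prop :=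
  A `<=` \bigcup_k U k /\ forall k, (diam (U k) <= delta%:E)%E.

Definition hausdorff_premeasure s delta A : \bar R :=
  ereal_inf [set (\sum_(0 <= k <oo) hausdorff_gauge s (U k))%E
            | U in [set U | delta_cover delta A U]].

Definition hausdorff_measure s A : \bar R :=
  ereal_sup [set hausdorff_premeasure s delta A
            | delta in [set delta | 0 < delta]].

Definition hausdorff_dim A : \bar R :=
  ereal_inf [set s%:E | s in [set s | 0 <= s /\ hausdorff_measure s A = 0%E]].

End hausdorff.

Section engel.
Context {R : realType}.
Implicit Types x : R.

(* For x in ]1/(n+1), 1/n] with n >= 1, n is the floor of 1/x; see
   [engel_mapE]. The values outside ]0, 1] are irrelevant. *)
Definition engel_map x : R :=
  let n : R := (Num.floor x^-1)%:~R in (x - (n + 1)^-1) * (n + 1).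

Definition engel_digit1 x : int := Num.floor x^-1 + 1.

(* Digits are indexed from 1; [engel_digit 0] is a junk value. *)
Definition engel_digit (n : nat) x : int :=
  engel_digit1 (iter n.-1 engel_map x).

Definition engel_digit_set x : set int :=
  [set engel_digit n x | n in [set n | (1 <= n)%N]].

Lemma engel_mapE (n : nat) x : (1 <= n)%N ->
  (n.+1%:R)^-1 < x <= (n%:R)^-1 ->
  engel_map x = (x - (n.+1%:R)^-1) * n.+1%:R.
Proof.
move=> n1 /andP[nx xn].
have n0 : 0 < n%:R :> R by rewrite ltr0n.
have n10 : 0 < n.+1%:R :> R by rewrite ltr0n.
have x0 : 0 < x by apply: lt_trans nx; rewrite invr_gt0.
have -> : engel_map x = (x - ((n%:Z)%:~R + 1)^-1) * ((n%:Z)%:~R + 1).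
  rewrite /engel_map; suff -> : Num.floor x^-1 = n%:Z by [].
  apply: floor_def; apply/andP; split.
    by rewrite -[leLHS]invrK lef_pV2 // posrE invr_gt0.
  rewrite intrD -[_ + _]/(n%:R + 1) natr1 -[ltRHS]invrK.
  by rewrite ltf_pV2 // posrE invr_gt0.
by rewrite -[(n%:Z)%:~R]/(n%:R) natr1.
Qed.

End engel.

(* f(n) -> +oo as n -> +oo *)
Definition int_cvg_pinfty (f : int -> int) : Prop :=
  forall M : int, exists N : int, forall n : int, N <= n -> M <= f n.

Definition contains_finite_patterns (F : set (int -> int)) (A : set int) :
    Prop :=
  forall (k : nat) (f : 'I_k -> int -> int), (forall i, F (f i)) ->
  exists2 n : nat, (1 <= n)%N & [set f i n%:Z | i in setT] `<=` A.

Definition engel_pattern_set (R : realType) (F : set (int -> int)) : set R :=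
  [set x | [/\ 0 < x <= 1,
      increasing_seq (fun n => engel_digit n.+1 x) &
      contains_finite_patterns F (engel_digit_set x)]].
Arguments engel_pattern_set R F : clear implicits.

(* Main.v *)
Require Import Defs.
From mathcomp Require Import all_boot all_order all_algebra.
From mathcomp Require Import all_classical all_reals all_analysis.
From mathcomp Require Import ring lra zify.

(* The patterns to be realized can be placed so far out that together they form
   a set P with only o(m) elements below 4^m. For t in [0, 1[, let the base-4
   expansion of t, cut into blocks of 0, 1, 2, ... digits, choose one number
   c_n in ]4^n, 4^(n+1)] outside P for each n, and let x(t) be the point whose
   Engel digits are the elements of P and the c_n in increasing order. If t and
   t' first differ in block n, then |t - t'| <= 4^-(n^2/2 + O(n)), whereas
   |x(t) - x(t')| >= 4^-(n^2/2 + o(n^2)): the elements of P contribute o(n)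
   factors of size at most 4^(n+2) to the product of the first digits. Hence
   x(t) |-> t is s-Hölder for every s < 1, and covers of the image of x pull
   back to covers of [0, 1[, which have total length at least 1. *)

Set Implicit Arguments.
Unset Strict Implicit.
Unset Printing Implicit Defensive.

Import Order.TTheory GRing.Theory Num.Theory.
Import numFieldNormedType.Exports.

Local Open Scope classical_set_scope.
Local Open Scope ring_scope.

(** * Engel sums *)

Definition shift_seq (T : Type) (d : nat -> T) : nat -> T := fun i => d i.+1.

Section engel_sum.
Variable R : realType.
Implicit Types d : nat -> nat.

(** The sum of 1/(d_0 ... d_i) over i < N, in nested form: removing the first digit, as the Engel
    map does, is then a computation step. *)
Fixpoint engel_psum d (N : nat) : R :=
  if N is N'.+1 then (1 + engel_psum (shift_seq d) N') / (d 0%N)%:R else 0.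

Definition engel_sum d : R := limn (engel_psum d).

Definition engel_seq d : Prop :=
  (2 <= d 0%N)%N /\ forall i, (d i < d i.+1)%N.

Lemma engel_seq_shift d : engel_seq d -> engel_seq (shift_seq d).
Proof.
by move=> [d0 dS]; split=> [|i];
  [exact: leq_trans d0 (ltnW (dS 0%N))|exact: dS].
Qed.

Lemma engel_seq_gt0 d : engel_seq d -> 0 < (d 0%N)%:R :> R.
Proof. by move=> [d0 _]; rewrite ltr0n (leq_trans _ d0). Qed.

Lemma engel_psum_ge0 d N : 0 <= engel_psum d N.
Proof. by elim: N d => //= N IH d; rewrite mulr_ge0 ?invr_ge0 ?addr_ge0. Qed.

(** Induction on N: with a = d_0, strict growth bounds the tail by 1/(d_1 - 1) <= 1/a, and (1 +
    1/a)(a - 1) = a - 1/a <= a. *)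
Lemma engel_psum_le d N : engel_seq d ->
  engel_psum d N <= ((d 0%N).-1)%:R^-1.
Proof.
elim: N d => [|N IH] d ed /=; first by rewrite invr_ge0.
have [d0 dS] := ed; have d1 := dS 0%N.
have le1 : engel_psum (shift_seq d) N <= (d 0%N)%:R^-1.
  apply: le_trans (IH _ (engel_seq_shift ed)) _.
  rewrite lef_pV2 ?posrE ?ltr0n ?ler_nat /shift_seq; lia.
have dp := engel_seq_gt0 ed.
have -> : (d 0%N).-1%:R = (d 0%N)%:R - 1 :> R.
  by rewrite -subn1 natrB //; lia.
have d2 : 2 <= (d 0%N)%:R :> R by rewrite ler_nat.
move: (_%:R) dp d2 le1 => a a0 a2 le1.
rewrite ler_pdivrMr // [leRHS]mulrC ler_pdivlMr; last lra.
apply: (@le_trans _ _ ((1 + a^-1) * (a - 1))); first by rewrite ler_wpM2r; lra.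
have -> : (1 + a^-1) * (a - 1) = a - a^-1 by field; lra.
by rewrite gerBl invr_ge0 ltW.
Qed.

Lemma engel_psum_nondecreasing d : nondecreasing_seq (engel_psum d).
Proof.
apply/nondecreasing_seqP => N; elim: N d => [|N IH] d.
  exact: engel_psum_ge0.
rewrite [leLHS]/= [leRHS]/= ler_wpM2r ?invr_ge0 //.
by rewrite lerD2l; exact: IH.
Qed.

Lemma engel_psum_cvg d : engel_seq d -> cvgn (engel_psum d).
Proof.
move=> ed; apply: nondecreasing_is_cvgn; first exact: engel_psum_nondecreasing.
by exists ((d 0%N).-1%:R^-1) => _ [N _ <-]; exact: engel_psum_le.
Qed.

Lemma engel_sum_le d : engel_seq d -> engel_sum d <= ((d 0%N).-1)%:R^-1.
Proof.
move=> ed; apply: limr_le; first exact: engel_psum_cvg.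
by apply: nearW => N; exact: engel_psum_le.
Qed.

Lemma engel_sum_ge d : engel_seq d -> (d 0%N)%:R^-1 <= engel_sum d.
Proof.
move=> ed; have := nondecreasing_cvgn_le (@engel_psum_nondecreasing d)
  (engel_psum_cvg ed) 1%N.
by rewrite /= addr0 mul1r.
Qed.

Lemma engel_sumE d : engel_seq d ->
  engel_sum d = (1 + engel_sum (shift_seq d)) / (d 0%N)%:R.
Proof.
move=> ed; apply/cvg_lim => //.
rewrite -cvg_shiftS /=.
apply: cvgM; last exact: cvg_cst.
apply: cvgD; first exact: cvg_cst.
exact: engel_psum_cvg (engel_seq_shift ed).
Qed.

Lemma engel_sum_gt0 d : engel_seq d -> 0 < engel_sum d.
Proof.
move=> ed; apply: lt_le_trans (engel_sum_ge ed).
by rewrite invr_gt0 engel_seq_gt0.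
Qed.

Lemma engel_sum_gt d : engel_seq d -> (d 0%N)%:R^-1 < engel_sum d.
Proof.
move=> ed; rewrite engel_sumE //
  -[ltLHS]mul1r ltr_pM2r ?invr_gt0 ?engel_seq_gt0//.
by rewrite ltrDl; exact: engel_sum_gt0 (engel_seq_shift ed).
Qed.

Lemma engel_sum_le1 d : engel_seq d -> engel_sum d <= 1.
Proof.
move=> ed; apply: le_trans (engel_sum_le ed) _.
have [d0 _] := ed.
by rewrite invf_le1 ?ler1n ?ltr0n; lia.
Qed.

(** The sum x satisfies 1/d_0 < x <= 1/(d_0 - 1); strictness on the left excludes 1/x = d_0. *)
Lemma floor_engel_sum d : engel_seq d ->
  Num.floor (engel_sum d)^-1 = ((d 0%N).-1)%:Z.
Proof.
move=> ed; have [d0 _] := ed; apply: floor_def.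
have x0 := engel_sum_gt0 ed; apply/andP; split.
  rewrite -[leLHS]invrK lef_pV2 ?posrE ?invr_gt0 ?ltr0n //; last by lia.
  exact: engel_sum_le.
have -> : ((d 0%N).-1%:Z + 1)%:~R = (d 0%N)%:R :> R.
  by have -> : (d 0%N).-1%:Z + 1 = (d 0%N)%:Z by lia.
rewrite -[ltRHS]invrK ltf_pV2 ?posrE ?invr_gt0 ?engel_seq_gt0 //.
exact: engel_sum_gt.
Qed.

Lemma engel_digit1_sum d : engel_seq d ->
  engel_digit1 (engel_sum d) = (d 0%N)%:Z.
Proof. by move=> ed; have [d0 _] := ed;
  rewrite /engel_digit1 floor_engel_sum //
    -[1]/(1%:Z) -PoszD addn1 prednK //; lia.
Qed.

Lemma engel_map_sum d : engel_seq d ->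
  engel_map (engel_sum d) = engel_sum (shift_seq d).
Proof.
move=> ed; have [d0 _] := ed; have dp := engel_seq_gt0 ed.
rewrite /engel_map floor_engel_sum //.
have -> : (d 0%N).-1%:~R + 1 = (d 0%N)%:R :> R.
  by rewrite -[_%:~R]/(_%:R) natr1 prednK //; lia.
rewrite (engel_sumE ed); field; lra.
Qed.

Lemma engel_digit_sum d n : engel_seq d ->
  engel_digit n.+1 (engel_sum d) = (d n)%:Z.
Proof.
rewrite /engel_digit /=; elim: n d => [|n IH] d ed;
  first exact: engel_digit1_sum.
by rewrite iterSr engel_map_sum // IH //; exact: engel_seq_shift.
Qed.

(** Common leading digits factor out of the difference. At index k, the tail for [d] is at least
    1/d_k + 1/(d_k d_(k+1)), while the tail for [d'] is at most 1/(d'_k - 1) <= 1/d_k. This leaves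
    the inverse of a product of k + 2 digits. *)
Lemma engel_sum_dist d d' k : engel_seq d -> engel_seq d' ->
  (forall i, (i < k)%N -> d i = d' i) -> (d k < d' k)%N ->
  (\prod_(i < k.+2) d i)%:R^-1 <= engel_sum d - engel_sum d'.
Proof.
elim: k d d' => [|k IH] d d' ed ed' dd' dk; have dp := engel_seq_gt0 ed.
  have le' : engel_sum d' <= (d 0%N)%:R^-1.
    apply: le_trans (engel_sum_le ed') _.
    move: dp dk; rewrite ltr0n => dp dk;
      rewrite lef_pV2 ?posrE ?ltr0n ?ler_nat; lia.
  have := engel_sum_ge (engel_seq_shift ed).
  rewrite (engel_sumE ed) !big_ord_recl big_ord0 muln1 natrM invfM /= /shift_seq.
  move=> le1.
  apply: le_trans (_ : (1 + (d 1%N)%:R^-1) / (d 0%N)%:R - (d 0%N)%:R^-1 <= _).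
    by rewrite mulrDl mul1r addrAC subrr add0r mulrC.
  by rewrite lerB // ler_wpM2r ?invr_ge0 ?lerD2l.
rewrite (engel_sumE ed) (engel_sumE ed') -(dd' 0%N) //
  -mulrBl opprD addrACA subrr add0r.
rewrite big_ord_recl natrM invfM mulrC ler_pM2r ?invr_gt0 //.
by apply: IH => //; [exact: engel_seq_shift|exact: engel_seq_shift|move=> i ik; exact: dd'].
Qed.

End engel_sum.

(** * Digit sets *)

Section enumeration.
Local Open Scope nat_scope.

Definition unbounded_pred (D : pred nat) : Prop :=
  forall m, exists n, (m < n) && D n.

Section enum_in.
Variables (D : pred nat) (Dub : unbounded_pred D).

Definition next_in (m : nat) : nat := ex_minn (Dub m).

(** The search starts above 1 because an [engel_seq] begins with a digit at least 2. *)
Fixpoint enum_in (k : nat) : nat :=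
  if k is k'.+1 then next_in (enum_in k') else next_in 1.

Lemma next_inP m : [/\ m < next_in m, D (next_in m) &
  forall p, m < p -> D p -> next_in m <= p].
Proof.
rewrite /next_in; case: ex_minnP => n /andP[mn Dn] minn; split => // p mp Dp.
by apply: minn; rewrite mp.
Qed.

Lemma enum_in_ltS k : enum_in k < enum_in k.+1.
Proof. by have [] := next_inP (enum_in k). Qed.

Lemma enum_in_gt1 : 1 < enum_in 0.
Proof. by have [] := next_inP 1. Qed.

Lemma enum_in_mem k : D (enum_in k).
Proof. by case: k => [|k] /=;
  [have [] := next_inP 1|have [] := next_inP (enum_in k)]. Qed.

Lemma enum_in_lt i j : (enum_in i < enum_in j) = (i < j).
Proof. by apply: leqW_mono; apply: leq_mono; apply: homo_ltn => //;
  [exact: ltn_trans|exact: enum_in_ltS]. Qed.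

Lemma enum_in_inj : injective enum_in.
Proof.
move=> i j eij; case: (ltngtP i j) => // ij; have := ij;
  by rewrite -enum_in_lt eij ltnn.
Qed.

(** The least k with p <= [enum_in k] works, since a step of the enumeration cannot jump over an
    element of [D]. *)
Lemma enum_in_surj p : 1 < p -> D p -> exists k, enum_in k = p.
Proof.
move=> p1 Dp.
have ge k : k <= enum_in k.
  by elim: k => // k IH; exact: leq_ltn_trans IH (enum_in_ltS k).
have [k kp kmin] := ex_minnP (ex_intro (fun k => p <= enum_in k) p (ge p)).
exists k; apply/eqP; rewrite eqn_leq kp andbT.
case: k kp kmin => [|k] kp kmin /=.
  by have [_ _ ->] := next_inP 1.
have [_ _ -> //] := next_inP (enum_in k).
by rewrite ltnNge; apply/negP => /kmin; rewrite ltnn.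
Qed.

End enum_in.

(** Both enumerations take the same steps until one hits [m] and the other skips it. This locates
    the first differing digit for [engel_sum_dist]. *)
Lemma enum_in_agree (D D' : pred nat) (Dub : unbounded_pred D)
    (Dub' : unbounded_pred D') (m : nat) :
  1 < m -> (forall p, p < m -> D p = D' p) -> D m -> ~~ D' m ->
  exists k, [/\ forall i, i < k -> enum_in Dub i = enum_in Dub' i,
    enum_in Dub k = m & m < enum_in Dub' k].
Proof.
move=> m1 agree Dm D'm; have [k km] := enum_in_surj Dub m1 Dm.
have next_agree q : q < m -> next_in Dub q < m -> next_in Dub q = next_in Dub' q.
  move=> qm nm; have [q1 q2 q3] := next_inP Dub q;
    have [q1' q2' q3'] := next_inP Dub' q.
  have le' : next_in Dub' q <= next_in Dub q
    by apply: q3' => //; rewrite -agree.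
  by apply/eqP; rewrite eqn_leq le' andbT q3 // agree // (leq_ltn_trans le').
have next_m q : q < m -> next_in Dub q = m -> m < next_in Dub' q.
  move=> qm nm; have [q1 q2 q3] := next_inP Dub q;
    have [q1' q2' q3'] := next_inP Dub' q.
  rewrite ltn_neqAle; apply/andP; split; first by apply: contraNneq D'm => ->.
  rewrite leqNgt; apply/negP => lt_m; have := q3 _ q1';
    rewrite agree // nm => /(_ q2').
  by rewrite leqNgt lt_m.
have ltm i : i < k -> enum_in Dub i < m by rewrite -km enum_in_lt.
have agreek i : i < k -> enum_in Dub i = enum_in Dub' i.
  elim: i => [|i IH] ik /=.
    by apply: next_agree => //; exact: ltm ik.
  by rewrite -IH ?(ltn_trans _ ik) //; apply: next_agree;
    [apply: ltm; lia|exact: ltm ik].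
exists k; split => //.
case: k km ltm agreek => [|k] km ltm agreek; first exact: next_m.
by rewrite /= -agreek //; apply: next_m => //; exact: ltm.
Qed.

Lemma leq_prod_subset (T : eqType) (s l : seq T) (w : T -> nat) :
  uniq s -> {subset s <= l} -> (forall x, x \in l -> 0 < w x) ->
  \prod_(x <- s) w x <= \prod_(x <- l) w x.
Proof.
elim: s l => [|x s IH] l /=;
  first by rewrite big_nil => _ _ w0; rewrite big_seq prodn_cond_gt0.
case/andP=> xs us sl w0; have xl : x \in l by apply: sl; rewrite mem_head.
rewrite big_cons (perm_big _ (perm_to_rem xl)) /= big_cons leq_mul2l IH ?orbT//.
  move=> y ys; have yl : y \in l by apply: sl; rewrite inE ys orbT.
  have := perm_mem (perm_to_rem xl) y; rewrite yl inE => /esym/orP[/eqP yx|//].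
  by rewrite -yx ys in xs.
by move=> y /mem_rem; exact: w0.
Qed.

Lemma leq_prod_expn (T : eqType) (l : seq T) (w : T -> nat) b :
  (forall x, x \in l -> w x <= b) -> \prod_(x <- l) w x <= b ^ size l.
Proof.
move=> wb; rewrite big_seq;
  apply: leq_trans (_ : \prod_(x <- l | x \in l) b <= _).
  exact: leq_prod.
by rewrite -big_seq big_const_seq count_predT iter_muln_1.
Qed.

End enumeration.

(** * Free digits between consecutive powers of 4 *)

Section blocks.
Local Open Scope nat_scope.
Variables (P : pred nat) (l : nat -> seq nat).
Hypothesis P_gt1 : forall p, P p -> 1 < p.
Hypothesis mem_l : forall m p, (p \in l m) = P p && (p <= 4 ^ m).
Hypothesis size_l : forall m, size (l m) <= m.

Definition block (n : nat) : seq nat :=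
  [seq p <- iota (4 ^ n).+1 (3 * 4 ^ n) | ~~ P p].

(* At most n + 1 of the 3 * 4 ^ n elements of ]4 ^ n, 4 ^ n.+1] are in P. *)
Lemma size_block n : 4 ^ n <= size (block n).
Proof.
rewrite size_filter.
have := count_predC P (iota (4 ^ n).+1 (3 * 4 ^ n)); rewrite size_iota.
have : count P (iota (4 ^ n).+1 (3 * 4 ^ n)) <= n.+1.
  rewrite -size_filter; apply: leq_trans (size_l n.+1).
  apply: uniq_leq_size; first by rewrite filter_uniq ?iota_uniq.
  move=> p; rewrite mem_filter mem_iota mem_l expnS => /andP[-> /=]; lia.
have : n < 4 ^ n by rewrite ltn_expl.
have -> : count (predC P) = count (fun p => ~~ P p) by [].
lia.
Qed.

Definition free_digit (n b : nat) : nat := nth 0 (block n) b.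

Lemma free_digitP n b : b < 4 ^ n ->
  [/\ 4 ^ n < free_digit n b,
    free_digit n b <= 4 ^ n.+1 & ~~ P (free_digit n b)].
Proof.
move=> bn; have := mem_nth 0 (leq_trans bn (size_block n)).
rewrite -/(free_digit n b) mem_filter mem_iota expnS => /andP[-> /andP[-> ?]].
by split=> //; lia.
Qed.

Lemma free_digit_inj n b b' : b < 4 ^ n -> b' < 4 ^ n ->
  free_digit n b = free_digit n b' -> b = b'.
Proof.
move=> bn bn' /eqP; rewrite nth_uniq ?(leq_trans _ (size_block n)) //.
  by move/eqP.
by rewrite filter_uniq ?iota_uniq.
Qed.

Definition digit_pred (b : nat -> nat) : pred nat :=
  fun p => `[< P p \/ exists n, free_digit n (b n) = p >].

Lemma digit_predP b p :
  reflect (P p \/ exists n, free_digit n (b n) = p) (digit_pred b p).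
Proof. exact: asboolP. Qed.

Section one_choice.
Variable b : nat -> nat.
Hypothesis b_lt : forall n, b n < 4 ^ n.

Lemma digit_pred_unbounded : unbounded_pred (digit_pred b).
Proof.
move=> m; exists (free_digit m (b m)); apply/andP; split.
  by have [+ _ _] := free_digitP (b_lt m); apply: ltn_trans; rewrite ltn_expl.
by apply/digit_predP; right; exists m.
Qed.

Lemma digit_pred_sub m p : digit_pred b p -> p <= 4 ^ m ->
  p \in l m ++ [seq free_digit i (b i) | i <- iota 0 m].
Proof.
move=> /digit_predP[Pp|[n <-]] pm; rewrite mem_cat.
  by rewrite mem_l Pp pm.
apply/orP; right; apply: map_f; rewrite mem_iota leq0n add0n /=.
by have [+ _ _] := free_digitP (b_lt n) => /leq_trans/(_ pm); rewrite ltn_exp2l.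
Qed.

(** The digits up to 4^m come from [l m] or from the free digits of blocks i < m. The latter are at
    most 4^(i+1) and give the exponent 1 + ... + m; each element of [l m] gives a factor at most
    4^m. *)
Lemma enum_digit_prod k m : enum_in digit_pred_unbounded k <= 4 ^ m ->
  \prod_(i < k.+1) enum_in digit_pred_unbounded i <=
  4 ^ ('C(m.+1, 2) + m * size (l m)).
Proof.
set d := enum_in _ => dk.
have -> : \prod_(i < k.+1) d i = \prod_(p <- [seq d i | i <- iota 0 k.+1]) p.
  by rewrite big_map -[iota 0 _]/(index_iota 0 k.+1) big_mkord.
apply: leq_trans (leq_prod_subset
  (l := l m ++ [seq free_digit i (b i) | i <- iota 0 m]) _ _ _) _.
- by rewrite map_inj_uniq ?iota_uniq //; exact: enum_in_inj.
- move=> p /mapP[i]; rewrite mem_iota => /andP[_ ik] ->; apply: digit_pred_sub.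
    exact: enum_in_mem.
  apply: leq_trans dk; rewrite leqNgt enum_in_lt; lia.
- move=> p; rewrite mem_cat mem_l => /orP[/andP[/P_gt1]|/mapP[i _ ->]];
  first by lia.
  by have [+ _ _] := free_digitP (b_lt i); lia.
rewrite big_cat /= expnD mulnC; apply: leq_mul.
  have -> : iota 0 m = index_iota 0 m by rewrite /index_iota subn0.
  (* The binomial is 0 + 1 + ... + m; dropping its zero term aligns index i with the bound
     4^(i+1). *)
  rewrite big_map -bin2_sum expn_sum !big_mkord.
  rewrite big_ord_recl expn0 mul1n; apply: leq_prod => i _.
  by have [_ + _] := free_digitP (b_lt i).
rewrite expnM; apply: leq_prod_expn => p; rewrite mem_l => /andP[] //.
Qed.

Lemma enum_digit_seq : engel_seq (enum_in digit_pred_unbounded).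
Proof. by split=> [|i]; [exact: enum_in_gt1|exact: enum_in_ltS]. Qed.

Variable R : realType.
Definition digit_seq_point : R := engel_sum R (enum_in digit_pred_unbounded).

End one_choice.

(** The digit sets first differ at the smaller of the two free digits of block n. The product in
    [engel_sum_dist] includes one digit more, so [enum_digit_prod] is applied with m = n + 2. *)
Lemma digit_seq_point_sep (R : realType) b b' (b_lt : forall n, b n < 4 ^ n)
    (b'_lt : forall n, b' n < 4 ^ n) n :
  (forall i, i < n -> b i = b' i) -> free_digit n (b n) < free_digit n (b' n) ->
  ((4 ^ ('C(n.+3, 2) + n.+2 * size (l n.+2)))%:R^-1 <=
   digit_seq_point b_lt R - digit_seq_point b'_lt R)%R.
Proof.
move=> bb' lt_c.
have [c1 c2 c3] := free_digitP (b_lt n);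
  have [c1' c2' c3'] := free_digitP (b'_lt n).
have late (e : nat -> nat) (e_lt : forall n, e n < 4 ^ n) i :
    n < i -> free_digit n (b n) < free_digit i (e i).
  move=> ni; have [+ _ _] := free_digitP (e_lt i); apply: leq_ltn_trans.
  by apply: leq_trans c2 _; rewrite leq_exp2l.
have agree p : p < free_digit n (b n) -> digit_pred b p = digit_pred b' p.
  move=> pc; apply/digit_predP/digit_predP => -[Pp|[i ip]]; (try by left);
    right;
    exists i; rewrite -{}ip in pc *; congr free_digit.
    have [/bb'//|/(late _ b_lt)|ni] := ltngtP i n;
      [by lia|by rewrite ni ltnn in pc].
  have [/bb'//|/(late _ b'_lt)|ni] := ltngtP i n;
    [by lia|rewrite ni in pc; lia].
have Dc : digit_pred b (free_digit n (b n))
  by apply/digit_predP; right; exists n.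
have D'c : ~~ digit_pred b' (free_digit n (b n)).
  apply/negP => /digit_predP[Pc|[i ic]]; first by rewrite Pc in c3.
  have [ni|/(late _ b'_lt)|ni] := ltngtP i n;
    [|by lia|by rewrite -ic ni ltnn in lt_c].
  have [_ + _] := free_digitP (b'_lt i); rewrite ic.
  have : 4 ^ i.+1 <= 4 ^ n by rewrite leq_exp2l.
  by lia.
have [k [ki dk d'k]] := enum_in_agree (digit_pred_unbounded b_lt)
  (digit_pred_unbounded b'_lt) (leq_ltn_trans (expn_gt0 4 n) c1) agree Dc D'c.
have := engel_sum_dist R (enum_digit_seq b_lt) (enum_digit_seq b'_lt) ki.
rewrite dk => /(_ d'k); apply: le_trans.
rewrite lef_pV2 ?posrE ?ltr0n ?expn_gt0 //; last first.
  by rewrite prodn_gt0 // => i;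
    have := enum_in_mem (digit_pred_unbounded b_lt) i;
    move=> /digit_predP[/P_gt1|[j <-]];
      [lia|have [+ _ _] := free_digitP (b_lt j); lia].
rewrite ler_nat; apply: enum_digit_prod => /=.
(* The digit following the free digit of block n is at most the free digit of block n + 1, hence at
   most 4^(n+2). *)
have [_ _] := next_inP (digit_pred_unbounded b_lt) (enum_in (digit_pred_unbounded b_lt) k).
have [e1 e2 _] := free_digitP (b_lt n.+1).
move=> /(_ (free_digit n.+1 (b n.+1))); rewrite dk => h; apply: leq_trans e2;
  apply: h.
  exact: late.
by apply/digit_predP; right; exists n.+1.
Qed.

End blocks.

(** * The Hölder estimate *)

(** Used to recover [base4 t n] from [base4 t n.+1] by deleting the last n base-4 digits. *)
Lemma truncn_divn (R : realType) (m : nat) (y : R) : (0 < m)%N -> 0 <= y ->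
  (Num.trunc (m%:R * y) %/ m)%N = Num.trunc y.
Proof.
move=> m0 y0; have mp : 0 < m%:R :> R by rewrite ltr0n.
have /andP[q1 q2] := truncn_itv y0.
have /andP[Q1 Q2] : _ <= m%:R * y < _ := truncn_itv (mulr_ge0 (ltW mp) y0).
move: (Num.trunc _) Q1 Q2 => Q Q1 Q2; move: (Num.trunc _) q1 q2 => q q1 q2.
have h1 : (m * q < Q.+1)%N.
  by rewrite -(ltr_nat R) natrM; apply: le_lt_trans Q2; rewrite ler_pM2l.
have h2 : (Q < m * q.+1)%N.
  by rewrite -(ltr_nat R) natrM; apply: le_lt_trans Q1 _; rewrite ltr_pM2l.
apply/eqP; rewrite eqn_leq -ltnS ltn_divLR // leq_divRL //; lia.
Qed.

Lemma binS2 n : 'C(n.+1, 2) = ('C(n, 2) + n)%N.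
Proof. by rewrite binS bin1. Qed.

Lemma double_bin2 n : (2 * 'C(n, 2) + n = n * n)%N.
Proof. by elim: n => // n IH; rewrite binS2; lia. Qed.

(** * Base-4 expansions cut into blocks *)

Section base4.
Variable R : realType.
Implicit Types t : R.

(* 'C(n, 2) = 0 + 1 + ... + (n - 1) is the total length of the first n blocks
   of digits. *)
Definition base4 t (n : nat) : nat := Num.trunc ((4 ^ 'C(n, 2))%:R * t).
Definition base4_block t (n : nat) : nat := (base4 t n.+1 %% 4 ^ n)%N.

Lemma base4_block_lt t n : (base4_block t n < 4 ^ n)%N.
Proof. by rewrite ltn_mod expn_gt0. Qed.

Lemma base4_agree t t' n : 0 <= t < 1 -> 0 <= t' < 1 ->
  (forall i, (i < n)%N -> base4_block t i = base4_block t' i) ->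
  base4 t n = base4 t' n.
Proof.
move=> /andP[t0 t1] /andP[t0' t1'].
have base0 u : 0 <= u -> u < 1 -> base4 u 0 = 0%N.
  by move=> u0 u1; apply/eqP;
    rewrite /base4 bin0n expn0 mul1r truncn_eq // u0 u1.
have baseS u i : 0 <= u -> base4 u i.+1 = (base4 u i * 4 ^ i + base4_block u i)%N.
  move=> u0; rewrite [LHS](divn_eq _ (4 ^ i)%N); congr (_ * _ + _)%N.
  rewrite /base4 binS2 addnC expnD natrM -mulrA truncn_divn ?expn_gt0 //.
  by rewrite mulr_ge0.
elim: n => [|n IH] h; first by rewrite !base0.
by rewrite !baseS // h // IH // => i ni; apply: h; rewrite ltnW.
Qed.

Lemma base4_dist t t' n : 0 <= t -> 0 <= t' -> base4 t n = base4 t' n ->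
  `|t - t'| <= (4 ^ 'C(n, 2))%:R^-1.
Proof.
move=> t0 t0' eqb; set M : R := (4 ^ _)%:R.
have M0 : 0 < M by rewrite ltr0n expn_gt0.
have /andP[] : _ <= M * t < _ := truncn_itv (mulr_ge0 (ltW M0) t0).
have /andP[] : _ <= M * t' < _ := truncn_itv (mulr_ge0 (ltW M0) t0').
rewrite -[Num.trunc _]/(base4 t' n) -[Num.trunc (M * t)]/(base4 t n) eqb -natr1.
move=> a1 a2 a3 a4; rewrite -[leRHS]mul1r ler_pdivlMr //.
rewrite -[X in _ * X](gtr0_norm M0) -normrM ler_norml mulrBl ![_ * M]mulrC; lra.
Qed.

(** If all blocks agreed, [base4_dist] would bound |t - t'| by 4^-n for every n. *)
Lemma base4_neq t t' : 0 <= t < 1 -> 0 <= t' < 1 -> t != t' ->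
  exists n, base4_block t n != base4_block t' n.
Proof.
move=> t01 t01' tt'; apply: contrapT => /forallNP h.
have {}h i : base4_block t i = base4_block t' i by apply/eqP;
  move/negP: (h i); rewrite negbK.
have d0 : 0 < `|t - t'| by rewrite normr_gt0 subr_eq0.
have [n nd] : exists n : nat, `|t - t'|^-1 < n%:R.
  by exists (Num.trunc (`|t - t'|^-1)).+1; exact: truncnS_gt.
have [/andP[t0 _] /andP[t0' _]] := (t01, t01').
have := base4_dist t0 t0' (base4_agree t01 t01' (n := n.+1) (fun i _ => h i)).
rewrite leNgt => /negP; apply.
rewrite -[ltRHS]invrK ltf_pV2 ?posrE ?invr_gt0 ?ltr0n ?expn_gt0 //.
apply: (lt_le_trans nd); rewrite ler_nat binS2.
apply: leq_trans (ltnW (ltn_expl n (isT : 1 < 4)%N)) _.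
by rewrite leq_exp2l // leq_addl.
Qed.

End base4.

Section holder.
Variables (P : pred nat) (l : nat -> seq nat).
Hypothesis P_gt1 : forall p, P p -> (1 < p)%N.
Hypothesis mem_l : forall m p, (p \in l m) = P p && (p <= 4 ^ m)%N.
Hypothesis size_l : forall m, (size (l m) <= m)%N.
Hypothesis sparse_l : forall a, exists A, forall m, (a * size (l m) <= m + A)%N.

(** The separation exponent is at most (1 + 1/a) 'C(n, 2) + O(1): 'C(n.+3, 2) exceeds 'C(n, 2) by 3n
    + 3, and sparsity makes the other term o(n^2). *)
Lemma sparse_exponent a : exists A, forall n,
  (a * ('C(n.+3, 2) + n.+2 * size (l n.+2)) <= a.+1 * ('C(n, 2) + A))%N.
Proof.
have [A hA] := sparse_l (4 * a).
pose B := (12 * a + 6 + A)%N.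
exists (B * B + 12 * a + 2 * A + 4)%N => n.
have := hA n.+2; have := double_bin2 n; rewrite !binS2.
move: (size _) ('C(n, 2)) => sz c cn szn.
have h1 : (n.+2 * (4 * a * sz) <= n.+2 * (n.+2 + A))%N by rewrite leq_mul2l szn orbT.
have h2 : (n * B <= n * n + B * B)%N by nia.
have h3 : (2 * (a * c) + a * n = a * (n * n))%N by rewrite -cn; lia.
rewrite /B in h2 *.
nia.
Qed.

Variable R : realType.

Definition digit_point (t : R) : R :=
  digit_seq_point mem_l size_l (base4_block_lt t) R.

(** Take n to be the first block where t and t' differ; the free digits chosen there differ by
    [free_digit_inj], and either one may be the smaller. *)
Lemma digit_point_sep (t t' : R) : 0 <= t < 1 -> 0 <= t' < 1 -> t != t' ->
  exists n, `|t - t'| <= (4 ^ 'C(n, 2))%:R^-1 /\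
    (4 ^ ('C(n.+3, 2) + n.+2 * size (l n.+2)))%:R^-1 <=
    `|digit_point t - digit_point t'|.
Proof.
move=> t01 t01' tt'; have [n bn bmin] := ex_minnP (base4_neq t01 t01' tt').
have agree i : (i < n)%N -> base4_block t i = base4_block t' i.
  by move=> ni; apply/eqP; apply: contraTT ni => /bmin; rewrite -leqNgt.
exists n; split.
  have [/andP[t0 _] /andP[t0' _]] := (t01, t01').
  by apply: base4_dist => //; exact: base4_agree.
have [lt_c|lt_c|] := ltngtP (free_digit P n (base4_block t n)) (free_digit P n (base4_block t' n)).
- apply: le_trans (ler_norm _).
  exact: digit_seq_point_sep.
- rewrite distrC; apply: le_trans (ler_norm _).
  by apply: digit_seq_point_sep => // i ni; rewrite agree.
move/(free_digit_inj mem_l size_l (base4_block_lt t n) (base4_block_lt t' n)) => eqb.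
by rewrite eqb eqxx in bn.
Qed.

Lemma digit_point_holder (s : R) : 0 <= s < 1 ->
  exists2 C, 0 < C & forall t t', 0 <= t < 1 -> 0 <= t' < 1 ->
    `|t - t'| <= C * `|digit_point t - digit_point t'| `^ s.
Proof.
move=> /andP[s0 s1].
(* This makes s <= a/(a + 1), so that s times the separation exponent is at most 'C(n, 2) + A, and
   the constant 4^A works. *)
pose a := Num.trunc ((1 - s)^-1).
have ha : (1 - s)^-1 < a.+1%:R by exact: truncnS_gt.
have {}ha : s * a.+1%:R <= a%:R.
  have : 1 < a.+1%:R * (1 - s) by rewrite -ltr_pdivrMr ?subr_gt0 // mul1r.
  rewrite -natr1; lra.
have [A hA] := sparse_exponent a.
exists (4 ^ A)%:R; first by rewrite ltr0n expn_gt0.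
move=> t t' t01 t01'; have [->|tt'] := eqVneq t t'.
  by rewrite subrr normr0 mulr_ge0 ?powR_ge0.
have [n [le1 le2]] := digit_point_sep t01 t01' tt'.
apply: le_trans le1 _; rewrite mulrC -ler_pdivrMr ?ltr0n ?expn_gt0 //.
rewrite -invfM -natrM -expnD.
set L := (_ + _ * _)%N in hA le2.
apply: (@le_trans _ _ ((4 ^ L)%:R^-1 `^ s)); last first.
  by apply: ge0_ler_powR => //; rewrite ?nnegrE ?invr_ge0.
have -> : (4 ^ L)%:R^-1 = (4 : R) `^ (- L%:R).
  by rewrite powRN powR_mulrn // natrX.
rewrite -powRrM mulNr powRN lef_pV2 ?posrE ?powR_gt0 ?ltr0n ?expn_gt0 //.
rewrite natrX -powR_mulrn // ler_powR ?ler1n //.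
have := hA n; rewrite -(ler_nat R) !natrM -/L => hAn.
have ap : 0 < a.+1%:R :> R by rewrite ltr0n.
rewrite -(ler_pM2l ap); apply: le_trans hAn.
apply: le_trans (_ : (s * a.+1%:R) * L%:R <= _); last by rewrite ler_wpM2r.
by rewrite le_eqVlt; apply/orP; left; apply/eqP; ring.
Qed.

End holder.

(** * Hausdorff dimension *)

Section hausdorff.
Variable R : realType.
Implicit Types (A U : set R) (s delta : R).

Lemma diam_ge A x y : A x -> A y -> (`|x - y|%:E <= diam A)%E.
Proof. by move=> Ax Ay; apply: ereal_sup_ubound; exists x => //; exists y. Qed.

Lemma diam_ge0 A : A !=set0 -> (0 <= diam A)%E.
Proof. by move=> [x Ax]; have := diam_ge Ax Ax; rewrite subrr normr0. Qed.

Lemma hausdorff_gauge_ge0 s A : (0 <= hausdorff_gauge s A)%E.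
Proof. by rewrite /hausdorff_gauge; case: ifP => // _; exact: poweR_ge0. Qed.

Lemma hausdorff_premeasure_ge0 s delta A :
  (0 <= hausdorff_premeasure s delta A)%E.
Proof.
apply: le_ereal_inf_tmp => _ [U _ <-]; apply: nneseries_ge0 => k _ _.
exact: hausdorff_gauge_ge0.
Qed.

Lemma hausdorff_measure_ge0 s A : (0 <= hausdorff_measure s A)%E.
Proof.
apply: le_trans (hausdorff_premeasure_ge0 s 1 A) _.
by apply: ereal_sup_ubound; exists 1 => //=.
Qed.

(** For the exponent 1 + e, N intervals of length 1/N have total gauge at most N^-e, which tends to
    0. *)
Lemma hausdorff_dim_le1 A : A `<=` `[0, 1] -> (hausdorff_dim A <= 1)%E.
Proof.
move=> A01; apply/lee_addgt0Pr => e e0.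
apply: ereal_inf_lbound; exists (1 + e) => //; split; first lra.
apply/eqP; rewrite eq_le hausdorff_measure_ge0 andbT.
apply: ge_ereal_sup => _ [delta /= d0 <-]; apply/lee_addgt0Pr => eta eta0.
rewrite add0e.
(* The first summand forces 1/N <= delta, the second N^-e <= eta. *)
pose N := (Num.trunc (delta^-1 + eta^-1 `^ e^-1)).+1.
have hN : delta^-1 + eta^-1 `^ e^-1 < N%:R by exact: truncnS_gt.
have p1 : 0 < delta^-1 by rewrite invr_gt0.
have p2 : 0 <= eta^-1 `^ e^-1 by exact: powR_ge0.
have N0 : 0 < N%:R :> R by rewrite ltr0n.
have Nd : N%:R^-1 <= delta by rewrite -[leRHS]invrK lef_pV2 ?posrE //; lra.
have Neta : N%:R `^ (- e) <= eta.
  rewrite powRN -[leRHS]invrK lef_pV2 ?posrE ?powR_gt0 ?invr_gt0 //.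
  have -> : eta^-1 = (eta^-1 `^ e^-1) `^ e.
    by rewrite -powRrM mulVf ?gt_eqF // powRr1 // invr_ge0 ltW.
  by apply: ge0_ler_powR; rewrite ?nnegrE; lra.
pose U k := if (k < N)%N
  then `[(k%:R / N%:R : R), k.+1%:R / N%:R]%classic else set0.
have dU k : (diam (U k) <= N%:R^-1%:E)%E.
  apply: ge_ereal_sup => _ [x Ux [y Uy <-]]; rewrite lee_fin.
  move: Ux Uy; rewrite /U; case: ifP => //= _;
    rewrite !in_itv /= -natr1 mulrDl mul1r.
  by move=> /andP[x1 x2] /andP[y1 y2]; rewrite ler_norml; apply/andP; split;
    lra.
apply: (@le_trans _ _ (\sum_(0 <= k <oo) hausdorff_gauge (1 + e) (U k))%E).
  apply: ereal_inf_lbound; exists U => //; split; last first.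
    by move=> k; apply: le_trans (dU k) _; rewrite lee_fin.
  move=> x /A01 /=; rewrite in_itv /= => /andP[x0 x1].
  (* At x = 1 the index trunc(N x) would be N, out of range; the last closed interval contains this
     point. *)
  have [->|x1'] := eqVneq x 1.
    exists N.-1 => //; rewrite /U /= ltnSn /= in_itv /= divff ?gt_eqF //
      lexx andbT.
    by rewrite ler_pdivrMr // mul1r ler_nat.
  have {x1 x1'}x1 : x < 1 by rewrite lt_neqAle x1'.
  have Nx0 : 0 <= N%:R * x by rewrite mulr_ge0.
  have /andP[k1 k2] := truncn_itv Nx0; exists (Num.trunc (N%:R * x)) => //.
  rewrite /U; have -> : (Num.trunc (N%:R * x) < N)%N.
    by rewrite -(ltr_nat R); apply: le_lt_trans k1 _; rewrite gtr_pMr.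
  by rewrite /= in_itv /= ler_pdivrMr // ler_pdivlMr // [x * _]mulrC k1 ltW.
rewrite (nneseries_split 0 N); last by move=> k _; exact: hausdorff_gauge_ge0.
rewrite add0n eseries0 ?adde0; last first.
  by move=> k Nk _; rewrite /U /= ltnNge Nk /= /hausdorff_gauge eqxx.
apply: (@le_trans _ _ (\sum_(0 <= k < N) (N%:R^-1 `^ (1 + e))%:E)%E).
  apply: lee_sum => k _; rewrite /hausdorff_gauge; case: ifPn => [_|/set0P Uk].
    by rewrite lee_fin powR_ge0.
  rewrite -poweR_EFin; apply: gt0_ler_poweR => //; first lra.
    by rewrite in_itv /= leey andbT; exact: diam_ge0.
  by rewrite in_itv /= leey andbT lee_fin invr_ge0.
rewrite sumEFin lee_fin sumr_const_nat subn0 -[leLHS]mulr_natl.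
apply: le_trans Neta.
have -> : N%:R^-1 `^ (1 + e) = N%:R^-1 * N%:R `^ (- e) :> R.
  rewrite powRD; last by rewrite invr_eq0 (gt_eqF N0) implybT.
  rewrite powRr1 ?invr_ge0 //.
  by rewrite -{2}(powR_inv1 (ltW N0)) -powRrM mulN1r.
by rewrite mulrA divff ?gt_eqF // mul1r.
Qed.

(** If a cover of [A] has parts [U k], the preimage of [U k] under f lies in an interval of length
    2C |U k|^s. These intervals cover [0, 1[, so the gauges sum to at least 1/(2C), and the
    s-measure is positive for every s < 1. *)
Lemma hausdorff_dim_ge1 A (f : R -> R) :
  (forall t, 0 <= t < 1 -> A (f t)) ->
  (forall s, 0 <= s < 1 -> exists2 C, 0 < C & forall t t', 0 <= t < 1 ->
     0 <= t' < 1 -> `|t - t'| <= C * `|f t - f t'| `^ s) ->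
  (1 <= hausdorff_dim A)%E.
Proof.
move=> fA holder; apply: le_ereal_inf_tmp => _ [s [s0 sA] <-].
rewrite lee_fin leNgt; apply/negP => s1.
have [C C0 hC] : exists2 C, 0 < C & forall t t', 0 <= t < 1 ->
    0 <= t' < 1 -> `|t - t'| <= C * `|f t - f t'| `^ s.
  by apply: holder; rewrite s0.
suff : ((2 * C)^-1%:E <= hausdorff_measure s A)%E.
  by rewrite sA lee_fin leNgt invr_gt0 mulr_gt0.
(* The scale 1 suffices: it ensures that the diameters are finite. *)
apply: le_trans (_ : hausdorff_premeasure s 1 A <= _)%E; last first.
  by apply: ereal_sup_ubound; exists 1 => //=.
apply: le_ereal_inf_tmp => _ [U [AU dU] <-].
have /choice[I hI] k : exists I : set R, [/\ measurable I,
    forall t, 0 <= t < 1 -> U k (f t) -> I t &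
    (lebesgue_measure I <= (2 * C)%:E * hausdorff_gauge s (U k))%E].
  have [[t0 [t01 Ut0]]|noU] := pselect (exists t, 0 <= t < 1 /\ U k (f t));
    last first.
    exists set0; split=> //; first by move=> t t01 Ut; case: noU; exists t.
    by rewrite measure0 mule_ge0 ?hausdorff_gauge_ge0 // lee_fin; lra.
  have Uk : U k !=set0 by exists (f t0).
  have dfin : diam (U k) \is a fin_num.
    rewrite fin_numElt (lt_le_trans ltNy0 (diam_ge0 Uk)) /=.
    by apply: le_lt_trans (dU k) _; rewrite ltry.
  have := @diam_ge (U k); have := diam_ge0 Uk; rewrite -(fineK dfin).
  set r := fine _ => r0 hr.
  exists `[t0 - C * r `^ s, t0 + C * r `^ s]%classic; split.
  - exact: measurable_itv.
  - move=> t t01' Ut; rewrite /= in_itv /=.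
    have : `|t - t0| <= C * r `^ s.
      apply: le_trans (hC _ _ t01' t01) _; rewrite ler_pM2l //.
      by apply: ge0_ler_powR; rewrite ?nnegrE // -lee_fin; exact: hr.
    by rewrite ler_distl.
  - rewrite lebesgue_measure_itv /= /hausdorff_gauge.
    have /set0P/negbTE -> := Uk.
    rewrite -(fineK dfin) -/r poweR_EFin -EFinM; case: ifP => _;
      rewrite ?lee_fin.
      by lra.
    by rewrite mulr_ge0 ?powR_ge0 //; lra.
suff h : (1 <= \sum_(0 <= k <oo) (2 * C)%:E * hausdorff_gauge s (U k))%E.
  rewrite nneseriesZl in h; last by move=> k _; exact: hausdorff_gauge_ge0.
  have C2 : 0 < 2 * C by rewrite mulr_gt0.
  by rewrite -[leLHS]mule1 lee_pdivrMl.
have mu1 : lebesgue_measure (`[0, 1[%classic : set R) = 1%E.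
  by rewrite lebesgue_measure_itv /= lte_fin ltr01 oppr0 adde0.
rewrite -mu1; apply: (@le_trans _ _ (\sum_(0 <= k <oo) lebesgue_measure (I k))%E).
  apply: measure_sigma_subadditive.
  - by move=> k; have [] := hI k.
  - exact: measurable_itv.
  - move=> t; rewrite /= in_itv /= => t01; have [k _ Uk] := AU _ (fA _ t01).
    by exists k => //; have [_ + _] := hI k; apply.
by apply: lee_nneseries => [k _ _|k _]; [exact: measure_ge0|have [] := hI k].
Qed.

End hausdorff.

(** * Sparse patterns *)

Section patterns.
Variable F : set (int -> int).
Hypothesis Fcount : countable F.
Hypothesis Finfty : forall f : int -> int, F f -> int_cvg_pinfty f.

Lemma pattern_enum : exists g : nat -> int -> int,
  (forall i, int_cvg_pinfty (g i)) /\ (forall f, F f -> exists i, g i = f).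
Proof.
have [e einj] := countable_injP _ Fcount.
have /choice[g hg] i : exists h : int -> int, int_cvg_pinfty h /\
    forall f, F f -> e f = i -> h = f.
  have [[f [Ff efi]]|noF] := pselect (exists f, F f /\ e f = i).
    exists f; split=> [|f' Ff' ef'i]; first exact: Finfty.
    by apply: einj; rewrite ?inE // efi.
  (* An index that codes no function of [F] receives the identity, which also tends to +oo. *)
  exists id; split; first by move=> M; exists M.
  by move=> f Ff efi; case: noF; exists f.
exists g; split=> [i|f Ff]; first by have [] := hg i.
by exists (e f); have [_] := hg (e f); apply.
Qed.

(* The cubic exponent makes P sparse: only the patterns j < J with J ^ 3 <= m,
   hence at most J ^ 2 numbers, matter below 4 ^ m. *)
Lemma pattern_spots (g : nat -> int -> int) :
  (forall i, int_cvg_pinfty (g i)) ->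
  exists n : nat -> nat, forall j, (1 <= n j)%N /\
    forall i, (i <= j)%N -> (4 ^ (j.+1 ^ 3))%:Z < g i (n j)%:Z.
Proof.
move=> ginf; suff /choice[n hn] : forall j, exists n, (1 <= n)%N /\
    forall i, (i <= j)%N -> (4 ^ (j.+1 ^ 3))%:Z < g i n%:Z by exists n.
move=> j.
suff [N hN] : exists N : nat, forall n : nat, (N <= n)%N ->
    forall i, (i < j.+1)%N -> (4 ^ (j.+1 ^ 3))%:Z < g i n%:Z.
  by exists N.+1; split=> // i ij; apply: hN.
move: (4 ^ (j.+1 ^ 3))%N => M; move: j.+1 => {}j.
elim: j => [|j [N hN]]; first by exists 0%N.
have [N' hN'] := ginf j (M.+1)%:Z.
exists (maxn N `|N'|%N) => n nN i; rewrite ltnS leq_eqVlt => /orP[/eqP ->|ij].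
  by apply: lt_le_trans (hN' n%:Z _); lia.
by apply: hN => //; lia.
Qed.

(** [P] collects the values of g_0, ..., g_j at the spot [n j], for all j. A finite subfamily of [F]
    lies among g_0, ..., g_j for some j, so its values at [n j] are all in [P]. *)
Lemma sparse_patterns : exists (P : pred nat) (l : nat -> seq nat),
  [/\ forall p, P p -> (1 < p)%N,
      forall m p, (p \in l m) = P p && (p <= 4 ^ m)%N,
      forall m, (size (l m) <= m)%N,
      forall a, exists A, forall m, (a * size (l m) <= m + A)%N &
      contains_finite_patterns F [set p%:Z | p in [set p | P p]]].
Proof.
have [g [ginf gsurj]] := pattern_enum.
have [n hn] := pattern_spots ginf.
(* For i <= j these values are positive, so the absolute value only changes the type. *)
pose val j i := `|g i (n j)%:Z|%N.
have val_gt j i : (i <= j)%N -> (4 ^ (j.+1 ^ 3) < val j i)%N.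
  by move=> ij; have [_ /(_ i ij)] := hn j; rewrite /val; lia.
pose P : pred nat := fun p => `[< exists j i, (i <= j)%N /\ val j i = p >].
(* [J m] is the integer cube root of m. *)
have /choice[J hJ] : forall m, exists J, (J ^ 3 <= m < J.+1 ^ 3)%N.
  elim=> [|m [J /andP[J1 J2]]]; first by exists 0%N.
  have [h|h] := leqP (J.+1 ^ 3) m.+1; last by exists J; rewrite h ltnW.
  exists J.+1; rewrite h /=; apply: leq_ltn_trans J2 _; rewrite ltn_exp2r //.
pose cand m := [seq val j i | j <- iota 0 (J m), i <- iota 0 (J m)].
pose l m := undup [seq p <- cand m | P p && (p <= 4 ^ m)%N].
have size_l m : (size (l m) <= J m * J m)%N.
  apply: leq_trans (size_undup _) _; rewrite size_filter.
  by apply: leq_trans (count_size _ _) _; rewrite size_allpairs !size_iota.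
exists P, l; split.
- move=> p /asboolP[j [i [/val_gt + <-]]]; apply: leq_ltn_trans.
  by rewrite expn_gt0.
- move=> m p; rewrite mem_undup mem_filter andb_idr //.
  move=> /andP[/asboolP[j [i [ij <-]]] pm].
  have jJ : (j < J m)%N.
    have := leq_trans (val_gt _ _ ij) pm; rewrite ltn_exp2l // => jm.
    have /andP[_ mJ] := hJ m.
    by have := ltn_trans jm mJ; rewrite ltn_exp2r.
  by apply: allpairs_f; rewrite mem_iota; lia.
- move=> m; apply: leq_trans (size_l m) _; have /andP[+ _] := hJ m.
  apply: leq_trans; rewrite !expnS expn0 muln1.
  by case: (J m) => // k; rewrite leq_pmull.
- move=> a; exists (a ^ 3)%N => m.
  have /andP[Jm _] := hJ m.
  apply: leq_trans (_ : a * (J m * J m) <= _)%N;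
    first by rewrite leq_mul2l size_l orbT.
  (* With J = [J m]: if a <= J, then a J^2 <= J^3 <= m; otherwise a J^2 <= a^3. *)
  have [aJ|Ja] := leqP a (J m).
    apply: leq_trans (leq_addr _ _); apply: leq_trans Jm.
    by rewrite !expnS expn0 muln1 leq_mul2r aJ orbT.
  apply: leq_trans (leq_addl _ _).
  by rewrite !expnS expn0 muln1 leq_mul2l leq_mul ?orbT // ltnW.
move=> k f Ff.
have /choice[h hh] : forall i : 'I_k, exists m, g m = f i.
  by move=> i; exact/gsurj/Ff.
pose j := \max_(i < k) h i.
have [nj gj] := hn j; exists (n j) => // _ [i _ <-].
have hij : (h i <= j)%N by rewrite /j; exact: leq_bigmax.
exists (val j (h i)).
  by apply/asboolP; exists j, (h i).
by rewrite -hh /val; have := gj _ hij; lia.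
Qed.

End patterns.

(** * The dimension of the pattern set *)

Unset Implicit Arguments.

Theorem theorem1p1 (R : realType) (F : set (int -> int))
  (Fcount : countable F)
  (Finfty : forall f : int -> int, F f -> int_cvg_pinfty f) :
  hausdorff_dim (engel_pattern_set R F) = 1%E.
Proof.
have [P [l [P_gt1 mem_l size_l sparse_l patt]]] :=
  sparse_patterns Fcount Finfty.
apply/eqP; rewrite eq_le; apply/andP; split.
  by apply: hausdorff_dim_le1 => x [/andP[x0 x1] _ _]; rewrite /= in_itv /= ltW.
apply: (@hausdorff_dim_ge1 R _ (@digit_point P l mem_l size_l R)) =>
  [t t01|s s01].
  have ed := enum_digit_seq mem_l size_l (base4_block_lt t).
  split; first by rewrite engel_sum_gt0 // engel_sum_le1.
    by move=> i j; rewrite !engel_digit_sum //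
      lez_nat leqNgt enum_in_lt -leqNgt.
  move=> k f /(patt k f)[n n1 nP]; exists n => // z /nP[p /= Pp <-].
  (* Every element of [P] exceeds 1, so the enumeration reaches it; the shift to i + 1 below is due
     to digits being indexed from 1. *)
  have [i ip] := enum_in_surj (digit_pred_unbounded mem_l size_l (base4_block_lt t))
    (P_gt1 _ Pp) (introT (digit_predP _ _ _) (or_introl Pp)).
  by exists i.+1 => //=; rewrite engel_digit_sum // ip.
exact: digit_point_holder.
Qed.
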